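(* Let $\mathbf{k}$ be a field of characteristic zero. Given integers $i,j,k\ge 2$, let $\phi$ denote the morphism $\phi=(T_i,T_j,T_k):\mathbb{A}^1\to\mathbb{A}^3$ over $\mathbf{k}$. Then $\phi$ is an embedding if and only if $\mathrm{pgcd}(i,j,k)=1$.
   Context: $T_n\in\mathbb{Z}[t]$ denotes the degree-$n$ Chebyshev polynomial of the first kind, given by $T_0=1$, $T_1=t$, $T_{n+1}=2tT_n-T_{n-1}$ for $n\ge 1$, regarded as an element of $\mathbf{k}[t]$. For positive integers $i,j,k$, the pairwise greatest common divisor is $\mathrm{pgcd}(i,j,k)=\max\{\gcd(i,j),\gcd(i,k),\gcd(j,k)\}$. A morphism $\phi=(f_1,f_2,f_3):\mathbb{A}^1\to\mathbb{A}^3$ given by $f_1,f_2,f_3\in\mathbf{k}[t]$ is an (algebraic line) embedding if and only if the corresponding $\mathbf{k}$-algebra map $\phi^*:\mathbf{k}[x,y,z]\to\mathbf{k}[t]$, $x\mapsto f_1$, $y\mapsto f_2$, $z\mapsto f_3$, is surjective, i.e. $\mathbf{k}[f_1,f_2,f_3]=\mathbf{k}[t]$. *)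

(* Defs.v *)
From HB Require Import structures.
From mathcomp Require Import all_boot all_order all_algebra.
From mathcomp Require Import mpoly.

Set Implicit Arguments.
Unset Strict Implicit.
Unset Printing Implicit Defensive.

Import GRing.Theory.
Local Open Scope ring_scope.

Fixpoint chebyshev (n : nat) : {poly int} :=
  match n with
  | 0 => 1
  | m.+1 => match m with
            | 0 => 'X
            | l.+1 => 2%:R * 'X * chebyshev m - chebyshev l
            end
  end.

Definition chebyshev_poly (K : fieldType) (n : nat) : {poly K} :=
  map_poly intr (chebyshev n).

Definition pgcd (i j k : nat) : nat :=
  maxn (gcdn i j) (maxn (gcdn i k) (gcdn j k)).

(* A morphism A^1 -> A^n over K is given by its n coordinate polynomials. Its
   comorphism is the K-algebra map K[x_1, ..., x_n] -> K[t] sending each x_i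
   to the i-th coordinate. *)
Definition comorphism (K : fieldType) (n : nat) (f : n.-tuple {poly K})
    (p : {mpoly K[n]}) : {poly K} :=
  mmap polyC (tnth f) p.

(* A morphism of affine schemes is a closed embedding iff its comorphism is
   surjective. *)
Definition is_embedding (K : fieldType) (n : nat) (f : n.-tuple {poly K}) :
    Prop :=
  forall q : {poly K}, exists p : {mpoly K[n]}, comorphism f p = q.

(* Main.v *)
Require Import Defs.
From HB Require Import structures.
From mathcomp Require Import all_boot all_order all_algebra.
From mathcomp Require Import mpoly.
From mathcomp Require Import ring zify.

(** Write V_n = U_(n-1) for the Chebyshev polynomials of the second kind.
    If i, j, k are pairwise coprime, then t V_j(T_i) is a polynomial in T_i and
    T_j, and t V_k(T_i) one in T_i and T_k. Since V_j and V_k are coprime, a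
    Bezout relation composed with T_i shows that t lies in K[T_i, T_j, T_k].

    Conversely, let a prime d divide i and j, and let K[t] act on functions
    g : Z -> K by (t g)(s) = (g(s + 1) + g(s - 1)) / 2, so that
    (T_n g)(s) = (g(s + n) + g(s - n)) / 2. The condition
    g(ad + bk) + g(ad - bk) = 0 for all integers a, b is preserved by T_i, T_j
    and T_k. If these generated K[t], it would be preserved by t, which at
    a = b = 0 reads g(1) + g(-1) = 0; some periodic g violates this. *)

Set Implicit Arguments.
Unset Strict Implicit.
Unset Printing Implicit Defensive.

Import GRing.Theory.
Local Open Scope ring_scope.

(** * Chebyshev identities of both kinds in K[t] *)

Section Chebyshev.
Variable K : fieldType.
Implicit Types (m n : nat) (p q : {poly K}).

Local Notation T := (chebyshev_poly K).

Lemma chebyshev_poly0 : T 0 = 1.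
Proof. by rewrite /chebyshev_poly rmorph1. Qed.

Lemma chebyshev_poly1 : T 1 = 'X.
Proof. by rewrite /chebyshev_poly /= map_polyX. Qed.

Lemma chebyshev_polySS n : T n.+2 = 2%:R * 'X * T n.+1 - T n.
Proof.
have -> : T n.+2 =
  map_poly intr (2%:R * 'X * chebyshev n.+1 - chebyshev n) by [].
by rewrite rmorphB !rmorphM rmorph_nat /= map_polyX.
Qed.

(* [chebyshevU n] is the polynomial usually written U_(n-1). *)
Fixpoint chebyshevU n : {poly K} :=
  match n with
  | 0 => 0
  | m.+1 => match m with
            | 0 => 1
            | l.+1 => 2%:R * 'X * chebyshevU m - chebyshevU l
            end
  end.

Local Notation V := chebyshevU.

Lemma chebyshevUSS n : V n.+2 = 2%:R * 'X * V n.+1 - V n.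
Proof. by []. Qed.

Lemma chebyshev_succ n :
  T n.+1 = 'X * T n + ('X ^+ 2 - 1) * V n /\ V n.+1 = T n + 'X * V n.
Proof.
elim: n => [|n [IHT IHU]].
  by rewrite chebyshev_poly0 chebyshev_poly1 /=; split; ring.
by rewrite chebyshev_polySS chebyshevUSS IHT IHU; split; ring.
Qed.

(** With s^2 = t^2 - 1 and (t + s)^n = T_n + s V_n, these are the two parts of (t + s)^(m + n);
    [chebyshev_pell] is the norm of (t + s)^n. *)
Lemma chebyshev_add m n :
  T (m + n) = T m * T n + ('X ^+ 2 - 1) * V m * V n /\
  V (m + n) = V m * T n + T m * V n.
Proof.
elim: m => [|m [IHT IHU]].
  by rewrite add0n chebyshev_poly0 /=; split; ring.
rewrite addSn.
have [-> ->] := chebyshev_succ (m + n); have [-> ->] := chebyshev_succ m.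
by rewrite IHT IHU; split; ring.
Qed.

Lemma chebyshev_pell n : T n ^+ 2 - ('X ^+ 2 - 1) * V n ^+ 2 = 1.
Proof.
elim: n => [|n IHn]; first by rewrite chebyshev_poly0 /=; ring.
by have [-> ->] := chebyshev_succ n; rewrite -[RHS]IHn; ring.
Qed.

Lemma chebyshev_consecutive n :
  T n.+1 * T n - ('X ^+ 2 - 1) * V n.+1 * V n = 'X.
Proof.
have [-> ->] := chebyshev_succ n.
by rewrite -[RHS]mulr1 -[in RHS](chebyshev_pell n); ring.
Qed.

Lemma chebyshevU_consecutive n : V n.+1 ^+ 2 - V n.+2 * V n = 1.
Proof.
elim: n => [|n IHn]; first by rewrite /=; ring.
by rewrite (chebyshevUSS n.+1) -[RHS]IHn (chebyshevUSS n); ring.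
Qed.

Lemma chebyshev_comp m n : T (m * n) = T m \Po T n.
Proof.
elim/ltn_ind: m => -[|[|m]] IHm.
- by rewrite mul0n chebyshev_poly0 comp_polyC.
- by rewrite mul1n chebyshev_poly1 comp_polyX.
rewrite chebyshev_polySS comp_polyB !comp_polyM comp_polyX -!IHm //.
rewrite -[in LHS](addn2 m) mulnDl mul2n -addnn addnA.
rewrite mulSnr -polyC_natr comp_polyC polyC_natr.
have [-> _] := chebyshev_add (m * n + n) n.
have [-> ->] := chebyshev_add (m * n) n.
(* The Pell identity for n enters as a factor 1 of [T (m * n)]. *)
rewrite -[X in _ = _ - X]mulr1 -[X in _ = _ - _ * X](chebyshev_pell n); ring.
Qed.

Lemma chebyshevU_comp m n : V (m * n) = (V m \Po T n) * V n.
Proof.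
elim/ltn_ind: m => -[|[|m]] IHm.
- by rewrite mul0n /= comp_poly0 mul0r.
- by rewrite mul1n /= comp_polyC mul1r.
rewrite chebyshevUSS comp_polyB !comp_polyM comp_polyX mulrBl -!mulrA -!IHm //.
rewrite -[in LHS](addn2 m) mulnDl mul2n -addnn addnA.
rewrite mulSnr -polyC_natr comp_polyC polyC_natr.
have [_ ->] := chebyshev_add (m * n + n) n.
have [-> ->] := chebyshev_add (m * n) n.
rewrite -[X in _ = _ - X]mulr1 -[X in _ = _ - _ * X](chebyshev_pell n); ring.
Qed.

Lemma coprime_consecutive_multiples m n :
  (0 < m)%N -> coprime m n -> exists a b, (a * m = (b * n).+1)%N.
Proof.
move=> m0 cmn; case: (egcdnP n m0) => a b e _; exists a, b.
by rewrite e (eqP cmn) addn1.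
Qed.

(** If am = bn + 1, then V_m divides V_(bn+1) and V_n divides V_(bn); [chebyshevU_consecutive] at bn
    is a Bezout relation for these multiples. *)
Lemma chebyshevU_bezout m n : (0 < m)%N -> coprime m n ->
  exists p q, p * V m + q * V n = 1.
Proof.
move=> m0 cmn; have [a [b e]] := coprime_consecutive_multiples m0 cmn.
have Em : V (b * n).+1 = (V a \Po T m) * V m by rewrite -e chebyshevU_comp.
exists ((V a \Po T m) * V (b * n).+1), (- V (b * n).+2 * (V b \Po T n)).
rewrite -mulrA (mulrC (V _)) mulrA -Em -mulrA -chebyshevU_comp mulNr.
by rewrite -expr2 chebyshevU_consecutive.
Qed.

(* With u = t + s, s^2 = t^2 - 1, one has u^n = T_n + s V_n, and t = T_(ai-bj)
   for ai = bj + 1. The factor V_j(T_i) turns the s-part of the addition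
   formula for T_(ai-bj) into a polynomial in T_i and T_j. *)
Lemma chebyshev_conductor i j : (0 < i)%N -> coprime i j ->
  exists p q r s : {poly K},
    (V j \Po T i) * 'X = (p \Po T i) * (q \Po T j) + (r \Po T i) * (s \Po T j).
Proof.
move=> i0 cij; have [a [b e]] := coprime_consecutive_multiples i0 cij.
exists (V j * T a), (T b), (V a), (- (V b * V i * ('X ^+ 2 - 1))).
rewrite -[X in _ * X = _](chebyshev_consecutive (b * j)) -e.
rewrite !chebyshev_comp !chebyshevU_comp.
rewrite [_ \Po T j in X in _ = _ + X]raddfN /= !comp_polyM comp_polyB.
rewrite comp_Xn_poly -[1]polyC1 comp_polyC polyC1.
(* Both sides are V_(ij); then (t^2 - 1) V_j^2 = T_j^2 - 1 absorbs the remaining factors into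
   K[T_j]. *)
have E : (V j \Po T i) * V i = (V i \Po T j) * V j.
  by rewrite -!chebyshevU_comp mulnC.
have := chebyshev_pell j => /(canRL (subrK _)) P.
rewrite P mulrBr.
rewrite (_ : _ * (_ * _ * _) = (V a \Po T i) * (V b \Po T j) *
  ((V j \Po T i) * V i) * V j * ('X ^+ 2 - 1)); last by ring.
by rewrite E; ring.
Qed.

End Chebyshev.

(** * The image of a comorphism as a subalgebra *)

Section Image.
Variables (K : fieldType) (n : nat) (f : n.-tuple {poly K}).

Definition in_image (q : {poly K}) := exists p, comorphism f p = q.

Lemma in_image_add p q : in_image p -> in_image q -> in_image (p + q).
Proof. by move=> [a <-] [b <-]; exists (a + b); rewrite /comorphism raddfD. Qed.

Lemma in_image_mul p q : in_image p -> in_image q -> in_image (p * q).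
Proof. by move=> [a <-] [b <-]; exists (a * b); rewrite /comorphism rmorphM. Qed.

Lemma in_image_polyC c : in_image c%:P.
Proof. by exists c%:MP; rewrite /comorphism mmapC. Qed.

Lemma in_image_tnth x : in_image (tnth f x).
Proof. by exists 'X_x; rewrite /comorphism mmapX mmap1U. Qed.

Lemma in_image_comp p q : in_image q -> in_image (p \Po q).
Proof.
move=> hq; elim/poly_ind: p => [|p c IHp].
  by rewrite comp_poly0; apply: in_image_polyC.
rewrite comp_poly_MXaddC; apply: in_image_add (in_image_polyC c).
exact: in_image_mul.
Qed.

Lemma image_ind (P : {poly K} -> Prop) :
  (forall c, P c%:P) -> (forall x, P (tnth f x)) ->
  (forall p q, P p -> P q -> P (p + q)) ->
  (forall p q, P p -> P q -> P (p * q)) ->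
  forall q, in_image q -> P q.
Proof.
move=> PC Pf PD PM _ [p <-]; rewrite /comorphism /mmap.
apply: (big_ind P) => [||m _]; [exact: (PC 0) | exact: (PD) |].
apply: (PM) => //; rewrite /mmap1.
apply: (big_ind P) => [||x _]; [exact: (PC 1) | exact: (PM) |].
elim: (m x) => [|e IHe]; first exact: (PC 1).
by rewrite exprS; apply: (PM).
Qed.

End Image.

(** * Embeddings from pairwise coprime indices *)

Section ImageChebyshev.
Variables (K : fieldType) (n : nat) (f : n.-tuple {poly K}).

Lemma in_image_chebyshev_conductor i j : (0 < i)%N -> coprime i j ->
  in_image f (chebyshev_poly K i) -> in_image f (chebyshev_poly K j) ->
  in_image f ((chebyshevU K j \Po chebyshev_poly K i) * 'X).
Proof.
move=> i0 cij hi hj; have [p [q [r [s ->]]]] := chebyshev_conductor K i0 cij.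
by apply: in_image_add; apply: in_image_mul; apply: in_image_comp.
Qed.

Lemma is_embedding_chebyshev i j k :
  (0 < i)%N -> (0 < j)%N -> coprime i j -> coprime i k -> coprime j k ->
  in_image f (chebyshev_poly K i) -> in_image f (chebyshev_poly K j) ->
  in_image f (chebyshev_poly K k) -> is_embedding f.
Proof.
move=> i0 j0 cij cik cjk hi hj hk.
have hX : in_image f 'X.
  have [p [q e]] := chebyshevU_bezout K j0 cjk.
  rewrite -['X]mul1r -[1](comp_polyC 1 (chebyshev_poly K i)) -[1%:P]e.
  rewrite comp_polyD !comp_polyM mulrDl -!mulrA.
  by apply: in_image_add; apply: in_image_mul;
    rewrite ?mulrA; do ?[exact: in_image_comp|exact: in_image_chebyshev_conductor].
by move=> q; rewrite -[q]comp_polyXr; apply: in_image_comp.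
Qed.

End ImageChebyshev.

(** * The averaging action of K[t] on functions Z -> K *)

Section Averaging.
Variables (K : fieldType) (nz2 : 2%:R != 0 :> K) (g : int -> K).
Implicit Types (p q : {poly K}) (s : int).

Definition average (h : int -> K) (s : int) := (h (s + 1) + h (s - 1)) / 2%:R.

(* [act p] is p applied to g, where t acts on functions by [average]. *)
Definition act (p : {poly K}) (s : int) :=
  \sum_(i < size p) p`_i * iter i average g s.

Lemma act_wide N p s : (size p <= N)%N ->
  act p s = \sum_(i < N) p`_i * iter i average g s.
Proof.
move=> le; rewrite /act (big_ord_widen N (fun i => p`_i * iter i average g s)) //.
rewrite big_mkcond; apply: eq_bigr => i _; case: ltnP => // h.
by rewrite nth_default ?mul0r.
Qed.

Lemma actD p q s : act (p + q) s = act p s + act q s.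
Proof.
set N := maxn (size p) (size q).
rewrite !(@act_wide N) ?leq_maxl ?leq_maxr ?size_polyD //.
by rewrite -big_split; apply: eq_bigr => i _; rewrite coefD mulrDl.
Qed.

Lemma actC c p s : act (c%:P * p) s = c * act p s.
Proof.
rewrite mul_polyC (@act_wide (size p)) ?size_scale_leq // mulr_sumr.
by apply: eq_bigr => i _; rewrite coefZ mulrA.
Qed.

Lemma act1 s : act 1 s = g s.
Proof. by rewrite /act size_poly1 big_ord1 coefC mul1r. Qed.

Lemma actX p s : act ('X * p) s = average (act p) s.
Proof.
rewrite (@act_wide (size p).+1); last first.
  by rewrite mulrC (leq_trans (size_polyMleq _ _)) // size_polyX addn2.
rewrite big_ord_recl coefXM mul0r add0r /average -big_split mulr_suml.
by apply: eq_bigr => i _; rewrite coefXM /= -mulrDr mulrA.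
Qed.

(** For the unit shift S, t acts as (S + S^-1)/2, and T_n((S + S^-1)/2) = (S^n + S^-n)/2. *)
Lemma act_chebyshev n p s :
  act (chebyshev_poly K n * p) s = (act p (s + n%:Z) + act p (s - n%:Z)) / 2%:R.
Proof.
elim/ltn_ind: n s => -[|[|n]] IHn s.
- by rewrite chebyshev_poly0 mul1r ?addr0 ?subr0; field.
- by rewrite chebyshev_poly1 actX.
rewrite chebyshev_polySS mulrBl -[- _]mulN1r -[-1]polyCN actD actC.
rewrite -polyC_natr -!mulrA actC actX /average !IHn //.
have -> : s + 1 + n.+1%:Z = s + n.+2%:Z by lia.
have -> : s + 1 - n.+1%:Z = s - n%:Z by lia.
have -> : s - 1 + n.+1%:Z = s + n%:Z by lia.
have -> : s - 1 - n.+1%:Z = s - n.+2%:Z by lia.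
by field.
Qed.

End Averaging.

(** * The obstruction from a common prime factor *)

Section Obstruction.
Variables (K : fieldType) (nz2 : 2%:R != 0 :> K) (d k : nat).
Variables (n : nat) (f : n.-tuple {poly K}).
Hypothesis f_cheb : forall x, exists2 l,
  tnth f x = chebyshev_poly K l & (d %| l)%N \/ l = k.

(* The odd functions in the second variable of (a, b) |-> h(ad + bk) are stable
   under the image: T_l shifts a when d divides l, and b when l = k. *)
Definition odd_along (h : int -> K) :=
  forall a b : int, h (a * d%:Z + b * k%:Z) + h (a * d%:Z - b * k%:Z) = 0.

Lemma odd_along_embedding g : is_embedding f -> odd_along g ->
  g 1 + g (-1) = 0.
Proof.
move=> emb hg.
(* Quantifying over all p makes [P] closed under products. *)
pose P q := forall p, odd_along (act g p) -> odd_along (act g (q * p)).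
have PX : P 'X.
  apply: (@image_ind _ _ f) (emb 'X) => [c|x|p q hp hq|p q hp hq] r hr.
  - by move=> a b; rewrite !actC -mulrDr hr mulr0.
  - have [l -> hl] := f_cheb x; move=> a b; rewrite !act_chebyshev // -mulrDl.
    apply/eqP; rewrite mulf_eq0; apply/orP; left; apply/eqP.
    (* A shift by l = cd moves a by c; a shift by k moves b by 1, and there the four terms pair
       crosswise. *)
    case: hl => [/dvdnP[c ->] | ->]; rewrite ?PoszM.
      have := hr (a + c%:Z) b; have := hr (a - c%:Z) b.
      rewrite !mulrDl !mulNr.
      set A := a * _; set B := b * _; set C := _ * d%:Z => e1 e2.
      transitivity (act g r (A - C + B) + act g r (A - C - B) +
        (act g r (A + C + B) + act g r (A + C - B))); last by rewrite e1 e2 addr0.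
      rewrite (addrAC A B C) (addrAC A B (- C)) (addrAC A (- B) C).
      by rewrite (addrAC A (- B) (- C)); ring.
    have := hr a (b + 1); have := hr a (b - 1).
    rewrite !mulrDl !mulNr mul1r !opprD opprK !addrA => e1 e2.
    set A := a * _ in e1 e2 *; set B := b * _ in e1 e2 *.
    set C := k%:Z in e1 e2 *.
    transitivity (act g r (A + B - C) + act g r (A - B + C) +
      (act g r (A + B + C) + act g r (A - B - C))); first by ring.
    by rewrite e1 e2 addr0.
  - move=> a b; rewrite !mulrDl !actD addrACA.
    by rewrite (hp r hr) (hq r hr) addr0.
  - by rewrite -mulrA; apply: hp; apply: hq.
have g1 : odd_along (act g 1) by move=> a b; rewrite !act1 hg.
have := PX 1 g1 0 0; rewrite !mul0r oppr0 !addr0 !actX /average !act1 !add0r.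
by rewrite -mulr2n -[_ / _ *+ 2]mulr_natr divfK.
Qed.

(** Since d divides ad + bk, it divides b, so the difference 2bk of the two numbers is a multiple of
    2dk. *)
Lemma dvd2_sign_change (a b : int) : coprime d k -> (0 < d)%N -> (0 < k)%N ->
  ((2 * d * k)%N%:Z %| a * d%:Z + b * k%:Z)%Z ->
  ((2 * d * k)%N%:Z %| a * d%:Z - b * k%:Z)%Z.
Proof.
move=> cdk d0 k0 h.
have db : (d%:Z %| b)%Z.
  have : (d%:Z %| a * d%:Z + b * k%:Z)%Z.
    by apply: dvdz_trans h; rewrite dvdzE /= mulnAC dvdn_mull.
  rewrite rpredDl; last exact: dvdz_mull.
  by rewrite Gauss_dvdzl // coprimezE.
have -> : a * d%:Z - b * k%:Z = a * d%:Z + b * k%:Z - b * (2 * k)%N%:Z.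
  by rewrite PoszM; ring.
rewrite rpredB //.
by rewrite -mulnA mulnCA (PoszM d); apply: dvdz_mul.
Qed.

Lemma chebyshev_not_embedding : prime d -> (2 <= k)%N -> ~ is_embedding f.
Proof.
move=> pd k2 emb; have d2 := prime_gt1 pd.
have d0 := ltnW d2; have k0 := ltnW k2.
case: (boolP (d %| k)%N) => dk.
  (* If d divides k, every ad + bk is a multiple of d, where this g vanishes, while g(1) + g(-1) =
     2. *)
  pose g (s : int) : K := (~~ (d%:Z %| s)%Z)%:R.
  have g0 a b : g (a * d%:Z + b * k%:Z) = 0.
    by rewrite /g rpredD // dvdz_mull.
  have := odd_along_embedding emb (g := g).
  rewrite /g !dvdzE /= dvdn1 (gtn_eqF d2) /= => H.
  have /eqP : (1 + 1 : K) = 0.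
    by apply: H => a b; rewrite -/(g _) -/(g _) -mulNr !g0 addr0.
  by rewrite -[1 + 1]/(2%:R) (negPf nz2).
have cdk : coprime d k by rewrite prime_coprime.
have /coprimezP[[u v] /= e] : coprimez d%:Z k%:Z by rewrite coprimezE.
(* The factor 2 keeps r apart from 1 when d = 2 and from -1 when k = 2. *)
pose N := (2 * d * k)%N%:Z; pose r := u * d%:Z - v * k%:Z.
have flip a b : (N %| a * d%:Z + b * k%:Z)%Z = (N %| a * d%:Z - b * k%:Z)%Z.
  apply/idP/idP => [|h]; first exact: dvd2_sign_change.
  have -> : b * k%:Z = - ((- b) * k%:Z) by ring.
  by apply: dvd2_sign_change => //; rewrite mulNr.
(* The map ad + bk |-> ad - bk is a well-defined involution modulo N that sends
   1 to r; g is the difference of the indicators of the classes of 1 and r. *)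
pose g (s : int) : K := (N %| s - 1)%Z%:R - (N %| s - r)%Z%:R.
have hg : odd_along g.
  (* With 1 = ud + vk, [flip] matches the four indicators in pairs of opposite sign. *)
  move=> a b; rewrite /g -{1 2}e /r.
  rewrite (_ : a * d%:Z + b * k%:Z - (u * d%:Z + v * k%:Z) =
    (a - u) * d%:Z + (b - v) * k%:Z); last by ring.
  rewrite flip.
  rewrite (_ : a * d%:Z + b * k%:Z - (u * d%:Z - v * k%:Z) =
    (a - u) * d%:Z + (b + v) * k%:Z); last by ring.
  rewrite flip.
  rewrite (_ : a * d%:Z - b * k%:Z - (u * d%:Z + v * k%:Z) =
    (a - u) * d%:Z - (b + v) * k%:Z); last by ring.
  rewrite (_ : a * d%:Z - b * k%:Z - (u * d%:Z - v * k%:Z) =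
    (a - u) * d%:Z - (b - v) * k%:Z); last by ring.
  by ring.
have := odd_along_embedding emb hg; rewrite /g subrr dvdz0.
have -> : (N %| -1 - 1)%Z = false.
  rewrite /N dvdzE /= -mulnA -[X in (_ %| X)%N]muln1 dvdn_pmul2l // dvdn1.
  by apply: gtn_eqF; nia.
(* 1 - r = 2vk, so d would divide v and hence 1. *)
have -> : (N %| 1 - r)%Z = false.
  apply/negP => h; have : (d%:Z %| v)%Z.
    have : (N %| v * (2 * k)%N%:Z)%Z.
      by rewrite (_ : v * _ = 1 - r) // -e /r PoszM; ring.
    by rewrite /N !dvdzE abszM /= (mulnC 2) -mulnA dvdn_pmul2r ?muln_gt0.
  move=> dv; have : (d%:Z %| u * d%:Z + v * k%:Z)%Z.
    by apply: rpredD; [apply: dvdz_mull | apply: dvdz_mulr].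
  by rewrite e dvdzE /= dvdn1 gtn_eqF.
(* -1 - r = -2ud, so k would divide u and hence 1. *)
have -> : (N %| -1 - r)%Z = false.
  apply/negP => h; have : (k%:Z %| u)%Z.
    have : (N %| u * (2 * d)%N%:Z)%Z.
      by rewrite (_ : u * _ = - (-1 - r)) ?rpredN // -e /r PoszM; ring.
    by rewrite /N !dvdzE abszM /= (mulnC _ k) dvdn_pmul2r ?muln_gt0.
  move=> ku; have : (k%:Z %| u * d%:Z + v * k%:Z)%Z.
    by apply: rpredD; [apply: dvdz_mulr | apply: dvdz_mull].
  by rewrite e dvdzE /= dvdn1 gtn_eqF.
by rewrite subr0 subr0 addr0 => /eqP; rewrite oner_eq0.
Qed.

End Obstruction.

(** A prime factor of gcd(i, j) serves as d. Asking only for membership in the list lets any two of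
    the three indices play i and j. *)
Lemma coprime_of_embedding (K : fieldType) (nz2 : 2%:R != 0 :> K)
    (n : nat) (f : n.-tuple {poly K}) (i j k : nat) :
  (forall x, exists2 l, tnth f x = chebyshev_poly K l & l \in [:: i; j; k]) ->
  (0 < i)%N -> (2 <= k)%N -> is_embedding f -> gcdn i j = 1%N.
Proof.
move=> f_cheb i0 k2 emb; apply/eqP; apply/negPn/negP => ne1.
have pd : prime (pdiv (gcdn i j)).
  by apply: pdiv_prime; rewrite ltn_neqAle eq_sym ne1 gcdn_gt0 i0.
apply: (chebyshev_not_embedding nz2 _ pd k2 emb) => x; have [l -> hl] := f_cheb x.
exists l => //; have dg := pdiv_dvd (gcdn i j).
move: hl; rewrite !inE => /or3P[] /eqP->; [left|left|by right].
  exact: dvdn_trans dg (dvdn_gcdl _ _).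
exact: dvdn_trans dg (dvdn_gcdr _ _).
Qed.

Theorem proposition4p1 (K : fieldType) (char0 : [pchar K] =i pred0)
    (i j k : nat) (hi : (2 <= i)%N) (hj : (2 <= j)%N) (hk : (2 <= k)%N) :
  is_embedding
    [tuple chebyshev_poly K i; chebyshev_poly K j; chebyshev_poly K k] <->
  pgcd i j k = 1%N.
Proof.
have nz2 : 2%:R != 0 :> K by have /pcharf0P-> := char0.
set f := [tuple _; _; _].
have i0 := ltnW hi; have j0 := ltnW hj; have k0 := ltnW hk.
rewrite /pgcd; split=> [emb | gcd1].
  have f_cheb (s : seq nat) : {subset [:: i; j; k] <= s} -> forall x, exists2 l,
      tnth f x = chebyshev_poly K l & l \in s.
    move=> hs [[|[|[|//]]] lt3]; [exists i|exists j|exists k];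
      by rewrite ?hs ?inE ?eqxx ?orbT.
  have hij := @coprime_of_embedding K nz2 _ f i j k.
  have hik := @coprime_of_embedding K nz2 _ f i k j.
  have hjk := @coprime_of_embedding K nz2 _ f j k i.
  rewrite hij ?hik ?hjk // => x; apply: f_cheb => y; rewrite !inE;
    by move=> /or3P[] ->; rewrite ?orbT.
have gij : (0 < gcdn i j)%N by rewrite gcdn_gt0 i0.
have gik : (0 < gcdn i k)%N by rewrite gcdn_gt0 i0.
have gjk : (0 < gcdn j k)%N by rewrite gcdn_gt0 j0.
apply: (@is_embedding_chebyshev _ _ _ i j k) => //; rewrite /coprime; try lia.
- exact: (in_image_tnth f (@Ordinal 3 0 isT)).
- exact: (in_image_tnth f (@Ordinal 3 1 isT)).
- exact: (in_image_tnth f (@Ordinal 3 2 isT)).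
Qed.
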